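(* Let $N\ge2$. The element $T_N=\prod^{\rightarrow}_{1\le a<b<c\le N+1}\mathbb R_{abc}$ (lexicographic order) satisfies $$T_N=\prod^{\rightarrow}_{1\le a<b\le N}\mathbb R_{ab}={\prod}'^{\,\rightarrow}_{1\le a<b\le N}\mathbb R_{ab},$$ $$T_N=\prod^{\rightarrow}_{1\le a<b<c\le N+1}\mathbb R_{abc}={\prod}'^{\,\rightarrow}_{1\le a<b<c\le N+1}\mathbb R_{abc},$$ $$T_N=\prod^{\rightarrow}_{1\le a<b<c\le N+1}\mathbb R_{a,\,c+a-b,\,c}={\prod}'^{\,\rightarrow}_{1\le a<b<c\le N+1}\mathbb R_{a,\,c+a-b,\,c}.$$ Here $\prod^{\rightarrow}$ (respectively ${\prod}'^{\,\rightarrow}$) denotes the product with factors written from left to right in increasing lexicographic (respectively colexicographic) order of the index tuple $(a,b)$ or $(a,b,c)$ over which the product is taken.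
   Context: Fix real $q\in(0,1)$. The quantum exponential is the formal series $\langle x\rangle_q=\sum_{n\ge 0}\frac{(-x)^n}{(1-q)(1-q^2)\cdots(1-q^n)}$. Quiver $Q_N$: its vertices are pairs of integers $(i,j)$ with $1\le i<j\le N$; its directed edges go from $(i,j)$ to $(i,j+1)$, from $(i,j)$ to $(i+1,j)$, and from $(i+1,j+1)$ to $(i,j)$, whenever both endpoints are vertices. Its skew-symmetric incidence matrix $B$ is: $B_{(i,j),(i',j')}=-B_{(i',j'),(i,j)}=1$ if there is a directed edge from $(i,j)$ to $(i',j')$, and $B_{(i,j),(i',j')}=0$ if the two vertices are not connected. $\mathcal T_N$ is the unital associative $\mathbb R$-algebra with generators $Z_{ij}$, $1\le i<j\le N$, and defining relations $Z_{ij}Z_{i'j'}=q^{B_{(i,j),(i',j')}}Z_{i'j'}Z_{ij}$. Quantum exponentials of monomials in the generators are formal series; they are regarded as elements of the completion of $\mathcal T_N$ consisting of all formal (possibly infinite) $\mathbb R$-linear combinations of the ordered monomials $\prod_{i<j}Z_{ij}^{\alpha_{ij}}$, $\alpha_{ij}\in\mathbb Z_{\ge0}$. For $1\le a<b<c\le N+1$ put $\mathbb R_{abc}=\langle Z_{a,b}Z_{a+1,b+1}\cdots Z_{a+c-b-1,\,c-1}\rangle_q$ (the product of $Z_{a+k,b+k}$ over $k=0,\dots,c-b-1$, with $k$ increasing from left to right). For $1\le a<b\le N$ put $\mathbb R_{ab}=\mathbb R_{a,b,b+1}\mathbb R_{a,b,b+2}\cdots\mathbb R_{a,b,N+1}$.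 Colexicographic order compares components starting from the right (e.g. $(a,b)$ precedes $(c,d)$ iff $b<d$, or $b=d$ and $a<c$). *)

(* Defs.v *)
From HB Require Import structures.
From mathcomp Require Import all_boot all_order all_algebra.
From mathcomp Require Import all_classical all_reals.
From mathcomp Require Import zify.

Set Implicit Arguments.
Unset Strict Implicit.
Unset Printing Implicit Defensive.

Import Order.TTheory GRing.Theory Num.Theory.

Local Open Scope ring_scope.

Definition lex2 : rel (nat * nat) :=
  fun s t => ((s : nat *l nat) <= t)%O.

Definition colex2 : rel (nat * nat) :=
  fun s t => lex2 (s.2, s.1) (t.2, t.1).

Definition lex3 : rel (nat * nat * nat) :=
  fun s t => ((s : (nat *l nat) *l nat) <= t)%O.

Definition colex3 : rel (nat * nat * nat) :=
  fun s t => lex3 (s.2, s.1.2, s.1.1) (t.2, t.1.2, t.1.1).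

Definition pairs (n : nat) : seq (nat * nat) :=
  [seq p <- [seq (a, b) | a <- index_iota 1 n.+1, b <- index_iota 1 n.+1]
     | (p.1 < p.2)%N].

Definition triples (n : nat) : seq (nat * nat * nat) :=
  [seq t <- [seq (p, c) | p <- pairs n, c <- index_iota 1 n.+1]
     | (t.1.2 < t.2)%N].

Definition is_vertex (N : nat) : pred ('I_N.+1 * 'I_N.+1) :=
  fun p => (0 < p.1 < p.2)%N.

(* Indices are 1-based: the value 0 of 'I_N.+1 is excluded by [is_vertex]. *)
Definition vertex (N : nat) := {p : 'I_N.+1 * 'I_N.+1 | is_vertex p}.

HB.instance Definition _ (N : nat) := Finite.on (vertex N).

Definition vpair (N : nat) (u : vertex N) : nat * nat :=
  (nat_of_ord (val u).1, nat_of_ord (val u).2).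

Definition quiver_edge (N : nat) (u v : vertex N) : bool :=
  let: (i, j) := vpair u in
  let: (i', j') := vpair v in
  [|| (i' == i) && (j' == j.+1),
      (i' == i.+1) && (j' == j)
    | (i == i'.+1) && (j == j'.+1)].

Definition incidence (N : nat) (u v : vertex N) : int :=
  if quiver_edge u v then 1 else if quiver_edge v u then -1 else 0.

Definition vlt (N : nat) (u v : vertex N) : bool :=
  (u != v) && lex2 (vpair u) (vpair v).

Definition mindex (N : nat) := {ffun vertex N -> nat}.

HB.instance Definition _ (N : nat) := Choice.on (mindex N).

Definition mcoef (N : nat) (a : mindex N) (v : vertex N) : nat :=
  (a : {ffun vertex N -> nat}) v.
Coercion mcoef : mindex >-> Funclass.

Definition mzero (N : nat) : mindex N := [ffun _ => 0%N].

Definition madd (N : nat) (a b : mindex N) : mindex N :=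
  [ffun v => (a v + b v)%N].

Definition msub (N : nat) (c a : mindex N) : mindex N :=
  [ffun v => (c v - a v)%N].

Definition mdeg (N : nat) (a : mindex N) : nat := (\sum_v a v)%N.

Definition mle (N : nat) (a c : mindex N) : bool :=
  [forall v, a v <= c v]%N.

(* A duplicate-free enumeration of the multi-indices a <= c, see [mem_below]
   and [below_uniq]. *)
Definition below (N : nat) (c : mindex N) : seq (mindex N) :=
  [seq a <- [seq ([ffun v => nat_of_ord (g v)] : mindex N)
               | g : {ffun vertex N -> 'I_(mdeg c).+1}]
     | mle a c].

(* Moving every Z_v of Z^b to the left of the Z_u of Z^a with v < u gives
   Z^a Z^b = q ^ (twist a b) Z^(a+b) for lexicographically ordered monomials. *)
Definition twist (N : nat) (a b : mindex N) : int :=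
  \sum_u \sum_(v | vlt v u) incidence u v * (a u)%:Z * (b v)%:Z.

Lemma lex2P (s t : nat * nat) :
  lex2 s t = (s.1 < t.1)%N || (s.1 == t.1) && (s.2 <= t.2)%N.
Proof.
case: s t => [a b] [c d]; rewrite /lex2 Order.ProdLexiOrder.lexi_pair /=.
by rewrite !leEnat; case: ltngtP.
Qed.

Lemma lex3P (s t : nat * nat * nat) :
  lex3 s t = [|| (s.1.1 < t.1.1)%N,
     (s.1.1 == t.1.1) && (s.1.2 < t.1.2)%N
   | [&& s.1.1 == t.1.1, s.1.2 == t.1.2 & (s.2 <= t.2)%N]].
Proof.
case: s t => [[a b] e] [[c d] f]; rewrite /lex3.
rewrite !Order.ProdLexiOrder.lexi_pair /=.
by rewrite !leEnat; case: ltngtP => //= _; case: ltngtP.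
Qed.

Section MultiIndex.
Variable N : nat.
Implicit Types a b c d : mindex N.

Lemma mindexP a b : (forall v, a v = b v) -> a = b.
Proof. by move=> ab; apply/ffunP => v; apply: ab. Qed.

Lemma mcoefE (F : vertex N -> nat) v : ([ffun x => F x] : mindex N) v = F v.
Proof. exact: ffunE. Qed.

Lemma mleP a c : reflect (forall v, a v <= c v)%N (mle a c).
Proof. exact: forallP. Qed.

Lemma mle_deg a v : (a v <= mdeg a)%N.
Proof. by rewrite /mdeg (bigD1 v) //= leq_addr. Qed.

Lemma mem_below c a : (a \in below c) = mle a c.
Proof.
rewrite mem_filter; case: mleP => //= ac; apply/mapP.
have H v : (a v < (mdeg c).+1)%N by rewrite ltnS (leq_trans (ac v)) ?mle_deg.
exists [ffun v => Ordinal (H v)]; first by rewrite mem_enum.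
by apply/mindexP => v; rewrite mcoefE ffunE.
Qed.

Lemma below_uniq c : uniq (below c).
Proof.
apply/filter_uniq; rewrite map_inj_uniq ?enum_uniq // => g h /ffunP gh.
by apply/ffunP => v; apply/val_inj; have := gh v; rewrite !ffunE.
Qed.

Lemma mle_trans b a c : mle a b -> mle b c -> mle a c.
Proof.
move=> /mleP ab /mleP bc; apply/mleP => v; exact: leq_trans (ab v) (bc v).
Qed.

Lemma mle_addr a b : mle a (madd a b).
Proof. by apply/mleP => v; rewrite mcoefE leq_addr. Qed.

Lemma mle_sub c a : mle (msub c a) c.
Proof. by apply/mleP => v; rewrite mcoefE leq_subr. Qed.

Lemma maddK a b : msub (madd a b) a = b.
Proof. by apply/mindexP => v; rewrite !mcoefE addKn. Qed.

Lemma msubK c a : mle a c -> madd a (msub c a) = c.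
Proof. by move=> /mleP ac; apply/mindexP => v; rewrite !mcoefE subnKC. Qed.

Lemma msubDA c a b : msub c (madd a b) = msub (msub c a) b.
Proof. by apply/mindexP => v; rewrite !mcoefE subnDA. Qed.

Lemma madd0m a : madd (mzero N) a = a.
Proof. by apply/mindexP => v; rewrite !mcoefE. Qed.

Lemma maddm0 a : madd a (mzero N) = a.
Proof. by apply/mindexP => v; rewrite !mcoefE addn0. Qed.

Lemma mle_add2l a b c : mle a c -> mle (madd a b) c = mle b (msub c a).
Proof.
move=> /mleP ac; apply/mleP/mleP => H v; have := H v; rewrite !mcoefE.
  by rewrite leq_subRL.
by rewrite leq_subRL.
Qed.

Lemma mdegD a b : mdeg (madd a b) = (mdeg a + mdeg b)%N.
Proof. by rewrite -big_split; apply: eq_bigr => v _; rewrite mcoefE. Qed.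

Lemma mdeg_eq0 a : mdeg a = 0%N -> a = mzero N.
Proof.
by move=> a0; apply/mindexP => v; apply/eqP; rewrite mcoefE -leqn0 -a0 mle_deg.
Qed.

Lemma big_belowDA (V : zmodType) (G : mindex N -> mindex N -> mindex N -> V) c :
  \sum_(d <- below c) \sum_(a <- below d) G a (msub d a) (msub c d) =
  \sum_(a <- below c) \sum_(b <- below (msub c a)) G a b (msub (msub c a) b).
Proof.
transitivity (\sum_(d <- below c) \sum_(a <- below c | mle a d)
                 G a (msub d a) (msub c d)).
  apply: eq_big_seq => d; rewrite mem_below => dc.
  rewrite -[RHS]big_filter; apply: perm_big.
  apply: uniq_perm => [||a]; [exact: below_uniq| |].
    exact/filter_uniq/below_uniq.
  rewrite mem_below mem_filter mem_below; case ad: (mle a d) => //=.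
  by rewrite (mle_trans ad dc).
rewrite (exchange_big_dep xpredT) //=.
apply: eq_big_seq => a; rewrite mem_below => ac.
transitivity (\sum_(d <- [seq madd a b | b <- below (msub c a)])
                 G a (msub d a) (msub c d)).
  rewrite -[LHS]big_filter; apply: perm_big.
  apply: uniq_perm; first exact/filter_uniq/below_uniq.
    by rewrite map_inj_uniq ?below_uniq // => b b' e; rewrite -(maddK a b) e maddK.
  move=> d; rewrite mem_filter mem_below; apply/andP/mapP.
    move=> [ad dc]; exists (msub d a); last by rewrite msubK.
    by rewrite mem_below -mle_add2l ?msubK.
  by move=> [b]; rewrite mem_below -mle_add2l // => ? ->; rewrite mle_addr.
by rewrite big_map; apply: eq_bigr => b _; rewrite maddK msubDA.
Qed.

Lemma twistDl a b c : twist (madd a b) c = twist a c + twist b c.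
Proof.
rewrite -big_split; apply: eq_bigr => u _; rewrite -big_split.
by apply: eq_bigr => v _; rewrite mcoefE PoszD mulrDr mulrDl.
Qed.

Lemma twistDr a b c : twist a (madd b c) = twist a b + twist a c.
Proof.
rewrite -big_split; apply: eq_bigr => u _; rewrite -big_split.
by apply: eq_bigr => v _; rewrite mcoefE PoszD mulrDr.
Qed.

Lemma twist0m a : twist (mzero N) a = 0.
Proof.
by apply: big1 => u _; apply: big1 => v _; rewrite mcoefE mulr0 mul0r.
Qed.

Lemma twistm0 a : twist a (mzero N) = 0.
Proof. by apply: big1 => u _; apply: big1 => v _; rewrite mcoefE mulr0. Qed.

End MultiIndex.

(* The completion of the algebra with generators Z_ij: f c is the coefficient
   of the lexicographically ordered monomial Z^c in the formal sum f.  The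
   argument hq serves to make the product below associative (q <> 0). *)
Definition qtorus (R : realType) (N : nat) (q : R) (hq : 0 < q < 1) : Type :=
  mindex N -> R.

Section QTorus.
Variables (R : realType) (N : nat) (q : R) (hq : 0 < q < 1).

Local Notation T := (qtorus N hq).

HB.instance Definition _ := GRing.Lmodule.copy T (mindex N -> R^o).

Implicit Types f g h : T.

Lemma qtorusP f g : (forall c, f c = g c) -> f = g.
Proof. by move=> fg; apply/funext. Qed.

Definition qmul f g : T := fun c =>
  \sum_(a <- below c) q ^ twist a (msub c a) * (f a * g (msub c a)).

(* the ordered monomial with exponents a *)
Definition qmon (a : mindex N) : T := fun c => (c == a)%:R.

Lemma q_neq0 : q != 0.
Proof. by case/andP: hq => q0 _; rewrite gt_eqF. Qed.

Lemma qmulA : associative qmul.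
Proof.
move=> f g h; apply/qtorusP => c; rewrite /qmul.
pose G a b d := q ^ (twist a b + twist a d + twist b d) * (f a * g b * h d).
transitivity (\sum_(a <- below c) \sum_(b <- below (msub c a))
   G a b (msub (msub c a) b)).
  apply: eq_big_seq => a; rewrite mem_below => ac.
  rewrite !mulr_sumr; apply: eq_big_seq => b; rewrite mem_below => bc.
  rewrite /G -twistDr msubK // expfzDr ?q_neq0 //.
  by rewrite -!mulrA; congr (_ * _); rewrite mulrCA.
rewrite -big_belowDA; apply: eq_big_seq => d; rewrite mem_below => dc.
rewrite mulr_suml mulr_sumr; apply: eq_big_seq => a; rewrite mem_below => ad.
rewrite /G -addrA -twistDl msubK // addrC expfzDr ?q_neq0 //.
by rewrite -!mulrA.
Qed.

Lemma qmon_mull a f c :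
  qmul (qmon a) f c =
  if mle a c then q ^ twist a (msub c a) * f (msub c a) else 0.
Proof.
rewrite /qmul; case: ifP => ac; last first.
  rewrite big_seq big1 // => b; rewrite mem_below /qmon.
  by case: eqP => [->|_]; rewrite ?ac // mul0r mulr0.
rewrite (bigD1_seq a) ?below_uniq ?mem_below //= /qmon eqxx mul1r big1 ?addr0 //.
by move=> b /negPf ->; rewrite mul0r mulr0.
Qed.

Lemma qmul1l : left_id (qmon (mzero N)) qmul.
Proof.
move=> f; apply/qtorusP => c; rewrite qmon_mull twist0m mul1r.
have -> : msub c (mzero N) = c by apply/mindexP => v; rewrite !mcoefE subn0.
by case: mleP => // -[] v; rewrite mcoefE.
Qed.

Lemma qmul1r : right_id (qmon (mzero N)) qmul.
Proof.
move=> f; apply/qtorusP => c; rewrite /qmul.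
have cc : msub c c = mzero N by apply/mindexP => v; rewrite !mcoefE subnn.
rewrite (bigD1_seq c) ?below_uniq ?mem_below //=; last exact/mleP.
rewrite cc twistm0 /qmon eqxx mulr1 mul1r big_seq_cond big1 ?addr0 // => a.
rewrite mem_below => /andP[ac /negP ca]; case: eqP => [e|]; last by rewrite !mulr0.
by case: ca; rewrite -(msubK ac) e maddm0.
Qed.

Lemma qmulDl : left_distributive qmul +%R.
Proof.
move=> f g h; apply/qtorusP => c; change (qmul (f + g) h c = qmul f h c + qmul g h c).
rewrite -big_split /=.
by apply: eq_bigr => a _; rewrite -mulrDr -mulrDl.
Qed.

Lemma qmulDr : right_distributive qmul +%R.
Proof.
move=> f g h; apply/qtorusP => c; change (qmul f (g + h) c = qmul f g c + qmul f h c).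
rewrite -big_split /=.
by apply: eq_bigr => a _; rewrite -!mulrDr.
Qed.

Lemma qone_neq0 : qmon (mzero N) != 0.
Proof.
apply/eqP => /(congr1 (fun f : T => f (mzero N))).
by rewrite /qmon eqxx => /eqP; rewrite oner_eq0.
Qed.

HB.instance Definition _ := GRing.Zmodule_isNzRing.Build T
  qmulA qmul1l qmul1r qmulDl qmulDr qone_neq0.

Lemma qscaleAl (k : R) (f g : T) : k *: (f * g) = k *: f * g.
Proof.
apply/qtorusP => c; rewrite [RHS]/(qmul _ _ c) [LHS]mulr_sumr.
by apply: eq_bigr => a _; rewrite mulrCA; congr (_ * _); exact: mulrA.
Qed.

Lemma qscaleAr (k : R) (f g : T) : k *: (f * g) = f * (k *: g).
Proof.
apply/qtorusP => c; rewrite [RHS]/(qmul _ _ c) [LHS]mulr_sumr.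
by apply: eq_bigr => a _; rewrite mulrCA; congr (_ * _); exact: mulrCA.
Qed.

HB.instance Definition _ := GRing.Lmodule_isLalgebra.Build R T qscaleAl.
HB.instance Definition _ := GRing.Lalgebra_isAlgebra.Build R T qscaleAr.


Lemma qmulE f g c :
  (f * g) c = \sum_(a <- below c) q ^ twist a (msub c a) * (f a * g (msub c a)).
Proof. by []. Qed.

Lemma qaddE f g c : (f + g) c = f c + g c. Proof. by []. Qed.

Lemma qscaleE (k : R) f c : (k *: f) c = k * f c. Proof. by []. Qed.

Lemma qsumE (I : Type) (r : seq I) (P : pred I) (F : I -> T) c :
  (\sum_(i <- r | P i) F i) c = \sum_(i <- r | P i) F i c.
Proof. by elim/big_rec2: _ => // i y x _ <-. Qed.

Lemma qmonE (a c : mindex N) : qmon a c = (c == a)%:R. Proof. by []. Qed.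

Lemma qmon0 : qmon (mzero N) = 1. Proof. by []. Qed.

Lemma qmonM (a b : mindex N) :
  qmon a * qmon b = q ^ twist a b *: qmon (madd a b).
Proof.
apply/qtorusP => c; rewrite [LHS]qmon_mull qscaleE /qmon.
have [-> | ne] := eqVneq c (madd a b); first by rewrite mle_addr maddK eqxx.
case: ifP => [ac|_]; last by rewrite mulr0.
case: eqP => [e|_]; last by rewrite !mulr0.
by case/eqP: ne; rewrite -e msubK.
Qed.

(* For indices (i, j) that are not a vertex this is 1. *)
Definition gen (i j : nat) : T :=
  qmon ([ffun v => nat_of_bool (vpair v == (i, j))] : mindex N).

(* The sum over all n of (- x)^n / ((1 - q)...(1 - q^n)), for x with zero
   constant term: by [qexpE] the omitted terms do not contribute to the
   coefficient of Z^c. *)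
Definition qexp (x : T) : T := fun c =>
  \sum_(n < (mdeg c).+1) ((\prod_(k < n) (1 - q ^+ k.+1))^-1 *: (- x) ^+ n) c.

Definition Rabc (a b c : nat) : T :=
  qexp (\prod_(0 <= k < c - b) gen (a + k) (b + k)).

Definition Rab (a b : nat) : T := \prod_(b.+1 <= c < N.+2) Rabc a b c.

Lemma qexp_term0 (x : T) (n : nat) (c : mindex N) :
  x (mzero N) = 0 -> (mdeg c < n)%N -> (x ^+ n) c = 0.
Proof.
move=> x0; elim: n c => // n IH c; rewrite ltnS => cn.
rewrite exprS qmulE big_seq big1 // => a; rewrite mem_below => ac.
have [/mdeg_eq0 -> | a0] := eqVneq (mdeg a) 0%N; first by rewrite x0 mul0r mulr0.
rewrite IH ?mulr0 //; apply: leq_trans cn.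
by rewrite -{2}(msubK ac) mdegD -[ltnLHS]add0n ltn_add2r lt0n.
Qed.

Lemma qexpE (x : T) (m : nat) (c : mindex N) :
  x (mzero N) = 0 -> (mdeg c < m)%N ->
  qexp x c =
  (\sum_(n < m) (\prod_(k < n) (1 - q ^+ k.+1))^-1 *: (- x) ^+ n) c.
Proof.
move=> x0 cm; rewrite qsumE /qexp.
rewrite -!(big_mkord xpredT (fun n =>
  ((\prod_(k < n) (1 - q ^+ k.+1))^-1 *: (- x) ^+ n) c)).
rewrite [RHS](big_cat_nat _ cm) //=.
rewrite [X in _ = _ + X]big_nat [X in _ = _ + X]big1 ?addr0 // => n /andP[cn _].
rewrite qscaleE qexp_term0 ?mulr0 //.
by rewrite -[LHS]/(- x (mzero N)) x0 oppr0.
Qed.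

End QTorus.

Arguments gen {R} N {q} hq i j.
Arguments Rabc {R} N {q} hq a b c.
Arguments Rab {R} N {q} hq a b.

(* [qtorus_relation], [qmon_ordered], [finsupp_span] and [qtorus_presentation]
   show that the elements of finite support form the algebra presented by the
   generators Z_ij and their q-commutation relations, with the ordered
   monomials as a basis; the product on [qtorus] is therefore the one induced
   by these relations.  In [finite_support], boundedness amounts to finiteness
   since there are finitely many multi-indices below a given one. *)

Section Presentation.
Variables (R : realType) (N : nat) (q : R) (hq : 0 < q < 1).

Local Notation T := (qtorus N hq).

Definition vgen (v : vertex N) : T := gen N hq (vpair v).1 (vpair v).2.

Definition vertices : seq (vertex N) :=
  sort (relpre (@vpair N) lex2) (enum {: vertex N}).

Definition qrelations (A : algType R) (z : vertex N -> A) : Prop :=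
  forall u v, z u * z v = q ^ incidence u v *: (z v * z u).

Definition bounded_by (c : mindex N) (f : T) : Prop :=
  forall a, ~~ mle a c -> f a = 0.

Definition finite_support (f : T) : Prop :=
  exists c : mindex N, bounded_by c f.

Definition zmon (A : algType R) (z : vertex N -> A) (a : mindex N) : A :=
  \prod_(v <- vertices) z v ^+ a v.

Lemma vpair_inj : injective (@vpair N).
Proof.
move=> [[a b] p] [[c d] r] [/val_inj e1 /val_inj e2]; apply/val_inj => /=.
by rewrite [a]e1 [b]e2.
Qed.

Lemma vltP (u v : vertex N) : vlt u v =
  ((vpair u).1 < (vpair v).1)%N ||
  ((vpair u).1 == (vpair v).1) && ((vpair u).2 < (vpair v).2)%N.
Proof.
rewrite /vlt lex2P -(inj_eq vpair_inj).
case: (vpair u) (vpair v) => [a b] [c d] /=; rewrite xpair_eqE.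
by case: ltngtP => //=; case: ltngtP.
Qed.

Lemma vlt_irr (u : vertex N) : vlt u u = false.
Proof. by rewrite /vlt eqxx. Qed.

Lemma vlt_total (u v : vertex N) : u != v -> vlt v u = ~~ vlt u v.
Proof.
rewrite !vltP -(inj_eq vpair_inj).
case: (vpair u) (vpair v) => [a b] [c d] /=; rewrite xpair_eqE.
by case: ltngtP => //=; case: ltngtP.
Qed.

Lemma incidence_anti (u v : vertex N) : incidence v u = - incidence u v.
Proof.
have no : quiver_edge u v -> ~~ quiver_edge v u.
  rewrite /quiver_edge; case: (vpair u) (vpair v) => [a b] [c d].
  by case/or3P => /andP[/eqP-> /eqP->]; rewrite !negb_or !negb_and; lia.
rewrite /incidence; case: ifP => [vu|_]; last by case: ifP; rewrite ?opprK ?oppr0.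
by case: ifP => [/no|_]; rewrite ?vu.
Qed.

Lemma incidence_self (u : vertex N) : incidence u u = 0.
Proof. by have := incidence_anti u u; lia. Qed.

Definition mdelta (v : vertex N) (n : nat) : mindex N :=
  [ffun u => if u == v then n else 0%N].

Lemma vgenE v : vgen v = qmon hq (mdelta v 1).
Proof. by []. Qed.

Lemma twist_deltal v n (b : mindex N) :
  twist (mdelta v n) b = \sum_(w | vlt w v) incidence v w * n%:Z * (b w)%:Z.
Proof.
rewrite /twist (bigD1 v) //= [X in _ + X]big1; last first.
  by move=> u /negPf uv; apply: big1 => w _; rewrite mcoefE uv mulr0 mul0r.
by rewrite addr0; apply: eq_bigr => w _; rewrite mcoefE eqxx.
Qed.

Lemma twist_delta u v :
  twist (mdelta u 1) (mdelta v 1) = if vlt v u then incidence u v else 0.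
Proof.
rewrite twist_deltal; case: ifP => vu.
  rewrite (bigD1 v) //= mcoefE eqxx !mulr1 big1 ?addr0 // => w /andP[_ /negPf wv].
  by rewrite mcoefE wv mulr0.
apply: big1 => w; rewrite mcoefE; case: eqP => [->|]; rewrite ?vu // mulr0 //.
Qed.

Lemma qtorus_relation : qrelations vgen.
Proof.
move=> u v; rewrite !vgenE !qmonM !twist_delta scalerA.
have -> : madd (mdelta u 1) (mdelta v 1) = madd (mdelta v 1) (mdelta u 1).
  by apply/mindexP => w; rewrite !mcoefE addnC.
congr (_ *: _); have [->|uv] := eqVneq u v.
  by rewrite incidence_self mul1r.
rewrite (vlt_total uv); case: (vlt u v) => /=; last by rewrite expr0z mulr1.
by rewrite -expfzDr ?(q_neq0 hq) // [incidence v u]incidence_anti subrr.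
Qed.

Lemma mem_vertices v : v \in vertices.
Proof. by rewrite mem_sort mem_enum. Qed.

Lemma vertices_sorted : pairwise (@vlt N) vertices.
Proof.
have tr : transitive (@vlt N).
  move=> v u w; rewrite !vltP; move: (vpair u) (vpair v) (vpair w).
  by move=> [? ?] [? ?] [? ?] /=; lia.
rewrite -(sorted_pairwise tr).
have tot : total (relpre (@vpair N) lex2).
  by move=> u v; rewrite /= !lex2P; lia.
have := sort_sorted tot (enum {: vertex N}); rewrite -/vertices.
have : uniq vertices by rewrite sort_uniq enum_uniq.
elim: vertices => // u [|v s] //= IH /andP[us us'] /andP[uv sv].
by rewrite IH // andbT /vlt uv andbT; apply: contraNneq us => ->; rewrite inE eqxx.
Qed.

Lemma vertices_uniq : uniq vertices.
Proof. by rewrite sort_uniq enum_uniq. Qed.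

Section Algebra.
Variables (A : algType R) (z : vertex N -> A) (zrel : qrelations z).

Let q0 := q_neq0 hq.

Let zX u v m n : z u ^+ m * z v ^+ n =
  q ^ (incidence u v * m%:Z * n%:Z) *: (z v ^+ n * z u ^+ m).
Proof.
have z1 k : z u * z v ^+ k = q ^ (incidence u v * k%:Z) *: (z v ^+ k * z u).
  elim: k => [|k IH]; first by rewrite !expr0 mulr0 mulr1 mul1r scale1r.
  rewrite exprS mulrA zrel -scalerAl -(mulrA (z v) (z u)) IH -scalerAr scalerA.
  rewrite -expfzDr // (mulrA (z v)); congr (q ^ _ *: _); lia.
elim: m => [|m IH]; first by rewrite !expr0 mulr0 mul0r mulr1 mul1r scale1r.
rewrite exprS -(mulrA (z u)) IH -scalerAr (mulrA (z u)) z1 -scalerAl scalerA.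
rewrite -(mulrA (z v ^+ n)) -expfzDr //; congr (q ^ _ *: _); lia.
Qed.

Let zm s (a : mindex N) : A := \prod_(v <- s) z v ^+ a v.

Let tw s (a b : mindex N) : int :=
  \sum_(u <- s) \sum_(v <- s | vlt v u) incidence u v * (a u)%:Z * (b v)%:Z.

Let zm_comm s a v n : zm s a * z v ^+ n =
  q ^ (\sum_(u <- s) incidence u v * (a u)%:Z * n%:Z) *: (z v ^+ n * zm s a).
Proof.
rewrite /zm; elim: s => [|u s IH].
  by rewrite !big_nil mulr1 mul1r scale1r.
rewrite !big_cons -(mulrA (z u ^+ _)) IH -scalerAr (mulrA (z u ^+ _)) zX.
rewrite -scalerAl scalerA -(mulrA (z v ^+ _)).
by rewrite -expfzDr // [X in q ^ X]addrC.
Qed.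

Let zm_mul s a b : pairwise (@vlt N) s ->
  zm s a * zm s b = q ^ tw s a b *: zm s (madd a b).
Proof.
elim: s => [|v s IH] /=.
  by move=> _; rewrite /zm /tw !big_nil mulr1 scale1r.
case/andP=> /allP vs /IH {}IH.
have -> : tw (v :: s) a b =
    \sum_(u <- s) incidence u v * (a u)%:Z * (b v)%:Z + tw s a b.
  rewrite /tw big_cons big_cons vlt_irr big_seq_cond big1 ?add0r => [|w].
    rewrite -big_split; apply: eq_big_seq => u us.
    by rewrite big_cons vs.
  case/andP=> /vs vw wv; move: vw; rewrite vlt_total ?wv //.
  by apply: contraTneq wv => ->; rewrite vlt_irr.
rewrite /zm !big_cons -!/(zm _ _) mcoefE exprD.
transitivity (z v ^+ a v * (zm s a * z v ^+ b v) * zm s b).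
  by rewrite !mulrA.
rewrite zm_comm -scalerAr -scalerAl (mulrA (z v ^+ a v)).
by rewrite -(mulrA (z v ^+ a v * _)) IH -scalerAr scalerA -expfzDr.
Qed.

Lemma zmonM a b : zmon z a * zmon z b = q ^ twist a b *: zmon z (madd a b).
Proof.
rewrite [LHS]zm_mul ?vertices_sorted //; congr (q ^ _ *: _).
have E (P : pred (vertex N)) (F : vertex N -> int) :
    \sum_(v <- vertices | P v) F v = \sum_(v | P v) F v.
  apply/perm_big/uniq_perm; rewrite ?vertices_uniq ?index_enum_uniq // => v.
  by rewrite mem_vertices mem_index_enum.
by rewrite /tw /twist E; apply: eq_bigr => u _; apply: E.
Qed.

Lemma zmon0 : zmon z (mzero N) = 1.
Proof. by apply: big1 => v _; rewrite mcoefE. Qed.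

Lemma zmon_delta v n : zmon z (mdelta v n) = z v ^+ n.
Proof.
suff H s : uniq s -> \prod_(w <- s) z w ^+ mdelta v n w =
    if v \in s then z v ^+ n else 1.
  by rewrite /zmon H ?vertices_uniq ?mem_vertices.
elim: s => [|w s IH] /=; first by rewrite big_nil.
case/andP=> ws /IH {}IH; rewrite big_cons IH mcoefE inE (eq_sym v).
by have [<-|_] := eqVneq w v; rewrite ?(negPf ws) ?mulr1 ?mul1r.
Qed.

End Algebra.

Lemma vgenX v n : vgen v ^+ n = qmon hq (mdelta v n).
Proof.
elim: n => [|n IH].
  by rewrite expr0 -qmon0; congr qmon; apply/mindexP => u; rewrite !mcoefE if_same.
rewrite exprS IH vgenE qmonM twist_deltal big1 => [|w wv].
  rewrite expr0z scale1r; congr qmon; apply/mindexP => u.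
  by rewrite !mcoefE; case: eqP.
by rewrite mcoefE; case: eqP wv => [->|_]; rewrite ?vlt_irr ?mulr0.
Qed.

Lemma qmon_ordered (a : mindex N) :
  qmon hq a = \prod_(v <- vertices) vgen v ^+ a v.
Proof.
suff H s : pairwise (@vlt N) s -> \prod_(v <- s) vgen v ^+ a v =
    qmon hq ([ffun v => if v \in s then a v else 0%N] : mindex N).
  rewrite H ?vertices_sorted //; congr qmon; apply/mindexP => v.
  by rewrite mcoefE mem_vertices.
elim: s => [|v s IH] /=.
  by move=> _; rewrite big_nil -qmon0; congr qmon; apply/mindexP => v; rewrite !mcoefE.
case/andP=> /allP vs /IH {}IH; rewrite big_cons IH vgenX qmonM.
rewrite twist_deltal big1 => [|w wv].
  rewrite expr0z scale1r; congr qmon; apply/mindexP => u; rewrite !mcoefE inE.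
  case: eqP => [->|//]; case: ifP => [/vs|_]; rewrite ?vlt_irr ?addn0 //.
rewrite mcoefE; case: ifP => [/vs vw|_]; last by rewrite mulr0.
move: wv; rewrite vlt_total ?vw //.
by apply: contraTneq vw => ->; rewrite vlt_irr.
Qed.

Lemma finsupp_span (f : T) (c : mindex N) : bounded_by c f ->
  f = \sum_(a <- below c) f a *: \prod_(v <- vertices) vgen v ^+ a v.
Proof.
move=> fc; apply/qtorusP => b; rewrite qsumE.
under eq_bigr => a _ do rewrite -qmon_ordered qscaleE /qmon.
case bc: (mle b c); last first.
  rewrite fc ?bc // big_seq big1 // => a; rewrite mem_below.
  by case: eqP => [<-|]; rewrite ?bc // mulr0.
rewrite (bigD1_seq b) ?mem_below ?below_uniq //= eqxx mulr1 big1 ?addr0 // => a.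
by rewrite eq_sym => /negPf ->; rewrite mulr0.
Qed.

Lemma bounded_byW c d (f : T) : mle c d -> bounded_by c f -> bounded_by d f.
Proof. by move=> cd fc a /negP ad; apply: fc; apply/negP => /mle_trans/(_ cd). Qed.

Lemma bounded_byZD c (k : R) (f g : T) :
  bounded_by c f -> bounded_by c g -> bounded_by c (k *: f + g).
Proof. by move=> fc gc a ac; rewrite qaddE qscaleE fc ?gc ?mulr0 ?addr0. Qed.

Lemma bounded_byM c d (f g : T) :
  bounded_by c f -> bounded_by d g -> bounded_by (madd c d) (f * g).
Proof.
move=> fc gd e /negP ecd; rewrite qmulE big_seq big1 // => a.
rewrite mem_below => ae; case ac: (mle a c); last first.
  by rewrite (fc a) ?ac // mul0r mulr0.
rewrite gd ?mulr0 //; apply/negP => /mleP ead; case: ecd; apply/mleP => v.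
have := ead v; move/mleP/(_ v): ac; move/mleP/(_ v): ae; rewrite !mcoefE; lia.
Qed.

Lemma finite_support_ZD (k : R) (f g : T) :
  finite_support f -> finite_support g -> finite_support (k *: f + g).
Proof.
move=> [c fc] [d gd]; exists (madd c d); apply: bounded_byZD.
  by apply: bounded_byW fc; exact: mle_addr.
by apply: bounded_byW gd; apply/mleP => v; rewrite mcoefE leq_addl.
Qed.

Lemma finite_support_M (f g : T) :
  finite_support f -> finite_support g -> finite_support (f * g).
Proof. by move=> [c fc] [d gd]; exists (madd c d); apply: bounded_byM. Qed.

Lemma bounded_by_mon a : bounded_by a (qmon hq a).
Proof. by move=> b; rewrite qmonE; case: eqP => // -> /mleP[]. Qed.

Lemma finite_support1 : finite_support 1.
Proof. exists (mzero N); exact: bounded_by_mon. Qed.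

Lemma finite_support_gen v : finite_support (vgen v).
Proof. exists (mdelta v 1); exact: bounded_by_mon. Qed.

Theorem qtorus_presentation (A : algType R) (z : vertex N -> A) :
  qrelations z ->
  exists phi : T -> A,
    [/\ phi 1 = 1,
        forall v, phi (vgen v) = z v,
        forall k f g, finite_support f -> finite_support g ->
          phi (k *: f + g) = k *: phi f + phi g
      & forall f g, finite_support f -> finite_support g ->
          phi (f * g) = phi f * phi g].
Proof.
move=> zrel.
pose ev c (f : T) : A := \sum_(a <- below c) f a *: zmon z a.
have evW c d f : mle c d -> bounded_by c f -> ev d f = ev c f.
  move=> cd fc; rewrite /ev (bigID (fun a => mle a c)) /=.
  rewrite [X in _ + X]big1 ?addr0 => [|a /fc ->]; last by rewrite scale0r.
  rewrite -big_filter; apply/perm_big/uniq_perm => [||a].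
  - exact/filter_uniq/below_uniq.
  - exact: below_uniq.
  rewrite mem_filter mem_below; apply/andP/idP => [[ac _]|].
    by rewrite mem_below.
  by rewrite mem_below => ac; rewrite ac (mle_trans ac cd).
have [phi phiE] : exists phi : T -> A,
    forall c f, bounded_by c f -> phi f = ev c f.
  exists (fun f => if pselect (finite_support f) is left H
                   then ev (projT1 (cid H)) f else 0) => c f fc.
  case: pselect => [H|[]]; last by exists c.
  case: cid => d fd /=; rewrite -(evW d (madd c d)) ?(evW c (madd c d)) //.
    exact: mle_addr.
  by apply/mleP => v; rewrite mcoefE leq_addl.
have phi_mon a : phi (qmon hq a) = zmon z a.
  rewrite (phiE a); last exact: bounded_by_mon.
  rewrite /ev (bigD1_seq a) ?mem_below ?below_uniq //=; last exact/mleP.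
  rewrite qmonE eqxx scale1r big1 ?addr0 // => b /negPf.
  by rewrite qmonE => ->; rewrite scale0r.
have phiD k f g : finite_support f -> finite_support g ->
    phi (k *: f + g) = k *: phi f + phi g.
  move=> [c fc] [d gd]; set e := madd c d.
  have {}fc : bounded_by e f by apply: bounded_byW fc; exact: mle_addr.
  have {}gd : bounded_by e g.
    by apply: bounded_byW gd; apply/mleP => v; rewrite mcoefE leq_addl.
  rewrite !(phiE e) //; last exact: bounded_byZD.
  rewrite /ev scaler_sumr -big_split; apply: eq_bigr => a _.
  by rewrite qaddE qscaleE scalerDl scalerA.
have fs0 : finite_support 0 by exists (mzero N).
have phi0 : phi 0 = 0.
  have := phiD 0 0 0 fs0 fs0; rewrite scaler0 addr0 => ->.
  rewrite (phiE (mzero N)) // scale0r add0r.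
  by apply: big1 => a _; rewrite scale0r.
have phi_sum (I : Type) (r : seq I) (k : I -> R) (F : I -> T) :
    (forall i, finite_support (F i)) ->
    phi (\sum_(i <- r) k i *: F i) = \sum_(i <- r) k i *: phi (F i) /\
    finite_support (\sum_(i <- r) k i *: F i).
  move=> FS; elim: r => [|i r [IH1 IH2]]; first by rewrite !big_nil.
  rewrite !big_cons phiD // IH1; split=> //; exact: finite_support_ZD.
exists phi; split=> //.
- by rewrite -qmon0 phi_mon zmon0.
- by move=> v; rewrite vgenE phi_mon zmon_delta expr1.
move=> f g [c fc] [d gd].
have fs_mon a : finite_support (qmon hq a).
  by exists a; exact: bounded_by_mon.
have fE : f = \sum_(a <- below c) f a *: qmon hq a.
  rewrite [LHS](finsupp_span fc).
  by apply: eq_bigr => a _; rewrite qmon_ordered.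
have gE : g = \sum_(a <- below d) g a *: qmon hq a.
  rewrite [LHS](finsupp_span gd).
  by apply: eq_bigr => a _; rewrite qmon_ordered.
have -> : f * g = \sum_(a <- below c) f a *:
    (\sum_(b <- below d) (g b * q ^ twist a b) *: qmon hq (madd a b)).
  rewrite [in LHS]fE mulr_suml; apply: eq_bigr => a _.
  rewrite -scalerAl [in LHS]gE mulr_sumr; congr (_ *: _).
  by apply: eq_bigr => b _; rewrite -scalerAr qmonM scalerA.
rewrite (phi_sum _ _ _ _ _).1 => [|a]; last by have [] := phi_sum _ (below d)
  (fun b => g b * q ^ twist a b) (fun b => qmon hq (madd a b)) (fun=> fs_mon _).
rewrite (phiE c f fc) (phiE d g gd) /ev mulr_suml; apply: eq_bigr => a _.
rewrite (phi_sum _ _ _ _ _).1 // -scalerAl mulr_sumr; congr (_ *: _).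
apply: eq_bigr => b _.
by rewrite phi_mon -scalerAr (zmonM zrel) // scalerA.
Qed.

End Presentation.

(* Main.v *)
(* The products differ only in the order of the factors, and any two factors
   whose order is reversed commute.  Indeed, for every reversed pair one of the
   two chains of generators is nested in the other: each of its generators is
   adjacent in the quiver either to no generator of the other chain or to two of
   them, with opposite orientations.  Hence all powers of q cancel, and the
   quantum exponentials of the two chains commute. *)

Require Import Defs.
From mathcomp Require Import all_boot all_order all_algebra.
From mathcomp Require Import all_classical all_reals.
From mathcomp Require Import zify.

Set Implicit Arguments.
Unset Strict Implicit.
Unset Printing Implicit Defensive.

Import Order.TTheory GRing.Theory Num.Theory.

Local Open Scope ring_scope.

(** Induction on [s1]: its head [x] splits [s2] as [u ++ x :: v]. Each [y] in [u] comes after [x] in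
    [s1] but before it in [s2], so the pair is reversed and [F x] moves to the front past all of
    [u]. *)
Lemma prod_reorder (A : nzRingType) (I : eqType) (r1 r2 : rel I)
    (s1 s2 : seq I) (F : I -> A) :
  perm_eq s1 s2 -> pairwise r1 s1 -> pairwise r2 s2 ->
  {in s1 &, forall x y, r1 x y -> r2 y x -> GRing.comm (F x) (F y)} ->
  \prod_(x <- s1) F x = \prod_(x <- s2) F x.
Proof.
elim: s1 s2 => [|x s1 IH] s2 ps; first by have := perm_size ps; case: s2 ps.
have xs2 : x \in s2 by rewrite -(perm_mem ps) mem_head.
move: ps; case/splitPr: s2 / xs2 => u v ps /= /andP[/allP r1x r1s].
rewrite pairwise_cat allrel_consr => /and3P[/andP[/allP ux uv] r2u].
move=> /= /andP[_ r2v] xyC.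
have {}ps : perm_eq s1 (u ++ v).
  by rewrite -(perm_cons x) (perm_trans ps) // perm_catC /= perm_cons perm_catC.
rewrite big_cons (IH (u ++ v)) //; first 1 last.
- by rewrite pairwise_cat uv r2u.
- by move=> y z ys zs; apply: xyC; rewrite inE (ys, zs) orbT.
rewrite !big_cat big_cons /= !mulrA; congr (_ * _).
rewrite big_seq; apply: commr_prod => y yu.
have ys : y \in s1 by rewrite (perm_mem ps) mem_cat yu.
by apply: xyC; rewrite ?inE ?eqxx ?ys ?orbT ?r1x //; exact: ux.
Qed.

(** * Index sets and their orderings *)

Lemma mem_pairs n a b : ((a, b) \in pairs n) = (0 < a < b)%N && (b <= n)%N.
Proof.
rewrite mem_filter /=; apply/andP/idP => [[ab /allpairsP[[x y] /= [xn yn]]]|abn].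
  by rewrite !mem_index_iota in xn yn => -[? ?]; subst; lia.
split; first lia.
by apply/allpairsP; exists (a, b); rewrite /= !mem_index_iota; split=> //; lia.
Qed.

Lemma mem_triples n a b c :
  ((a, b, c) \in triples n) = (0 < a < b)%N && (b < c <= n)%N.
Proof.
rewrite mem_filter /=; apply/andP/idP => [[bc /allpairsP[[[x y] z] /= []]]|abn].
  by rewrite mem_pairs mem_index_iota => xn yn [? ? ?]; subst; lia.
split; first lia; apply/allpairsP; exists (a, b, c).
by rewrite /= mem_pairs mem_index_iota; split=> //; lia.
Qed.

Lemma pairs_uniq n : uniq (pairs n).
Proof.
apply/filter_uniq/allpairs_uniq; rewrite ?iota_uniq //.
by move=> [? ?] [? ?].
Qed.

Lemma triples_uniq n : uniq (triples n).
Proof.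
apply/filter_uniq/allpairs_uniq; rewrite ?iota_uniq ?pairs_uniq //.
by move=> [? ?] [? ?].
Qed.

Lemma sort_lex2 s : pairwise lex2 (sort lex2 s).
Proof.
have tr : transitive lex2.
  by move=> [? ?] [? ?] [? ?]; rewrite !lex2P /=; lia.
have tot : total lex2 by move=> [? ?] [? ?]; rewrite !lex2P /=; lia.
by rewrite -sorted_pairwise // sort_sorted.
Qed.

Lemma sort_colex2 s : pairwise colex2 (sort colex2 s).
Proof.
have tr : transitive colex2.
  by move=> [? ?] [? ?] [? ?]; rewrite /colex2 !lex2P /=; lia.
have tot : total colex2 by move=> [? ?] [? ?]; rewrite /colex2 !lex2P /=; lia.
by rewrite -sorted_pairwise // sort_sorted.
Qed.

Lemma sort_lex3 s : pairwise lex3 (sort lex3 s).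
Proof.
have tr : transitive lex3.
  by move=> [[? ?] ?] [[? ?] ?] [[? ?] ?]; rewrite !lex3P /=; lia.
have tot : total lex3 by move=> [[? ?] ?] [[? ?] ?]; rewrite !lex3P /=; lia.
by rewrite -sorted_pairwise // sort_sorted.
Qed.

Lemma sort_colex3 s : pairwise colex3 (sort colex3 s).
Proof.
have tr : transitive colex3.
  by move=> [[? ?] ?] [[? ?] ?] [[? ?] ?]; rewrite /colex3 !lex3P /=; lia.
have tot : total colex3.
  by move=> [[? ?] ?] [[? ?] ?]; rewrite /colex3 !lex3P /=; lia.
by rewrite -sorted_pairwise // sort_sorted.
Qed.

(** * Commutation of chains and of their quantum exponentials *)

Section Commutation.
Variables (R : realType) (N : nat) (q : R) (hq : 0 < q < 1).

Local Notation T := (qtorus N hq).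

Lemma vertex_of (i j : nat) : (0 < i < j)%N && (j <= N)%N ->
  exists v : vertex N, vpair v = (i, j).
Proof.
move=> ijN; have iN : (i < N.+1)%N by lia.
have jN : (j < N.+1)%N by lia.
have ij : is_vertex (Ordinal iN, Ordinal jN) by rewrite /is_vertex /=; lia.
by exists (exist (fun p => is_vertex p) _ ij).
Qed.

(** Coordinates replace vertices here, so that adjacency along a chain is a question of linear
    arithmetic. *)
Definition nat_edge (i j i' j' : nat) : bool :=
  [|| (i' == i) && (j' == j.+1), (i' == i.+1) && (j' == j)
    | (i == i'.+1) && (j == j'.+1)].

Lemma gen_qcomm i j i' j' :
  (0 < i < j)%N && (j <= N)%N -> (0 < i' < j')%N && (j' <= N)%N ->
  gen N hq i j * gen N hq i' j' =
  q ^ ((nat_edge i j i' j')%:Z - (nat_edge i' j' i j)%:Z)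
    *: (gen N hq i' j' * gen N hq i j).
Proof.
move=> /vertex_of[u uE] /vertex_of[v vE].
have := qtorus_relation hq u v; rewrite /vgen uE vE => ->; congr (q ^ _ *: _).
rewrite /incidence /quiver_edge uE vE -/(nat_edge i j i' j').
rewrite -/(nat_edge i' j' i j).
have: ~~ (nat_edge i j i' j' && nat_edge i' j' i j) by rewrite /nat_edge; lia.
by case: (nat_edge i j i' j'); case: nat_edge.
Qed.

Lemma prod_qcomm (z : nat -> T) (y : T) (e : nat -> int) n :
  (forall k, (k < n)%N -> z k * y = q ^ e k *: (y * z k)) ->
  (\prod_(0 <= k < n) z k) * y =
  q ^ (\sum_(0 <= k < n) e k) *: (y * \prod_(0 <= k < n) z k).
Proof.
elim: n => [|n IH] zy; first by rewrite !big_nil mul1r mulr1 scale1r.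
rewrite !big_nat_recr //= -mulrA zy // -scalerAr (mulrA _ y) IH => [|k kn].
  by rewrite -scalerAl scalerA -expfzDr ?(q_neq0 hq) // addrC mulrA.
by rewrite zy // leqW.
Qed.

Lemma sum_eqn (b u n : nat) :
  \sum_(0 <= k < n) (b + k == u)%N%:Z = (b <= u < b + n)%N%:Z.
Proof.
elim: n => [|n IH]; first by rewrite big_nil; lia.
by rewrite big_nat_recr //= IH; lia.
Qed.

Definition chain (a b c : nat) : T :=
  \prod_(0 <= k < c - b) gen N hq (a + k) (b + k).

(** The first generator of the chain divides each of its monomials. This is the condition under
    which [qexpE] lets the exponential be truncated. *)
Lemma chain0 a b c : (0 < a < b)%N -> (b < c <= N.+1)%N ->
  chain a b c (mzero N) = 0.
Proof.
move=> ab bc; rewrite /chain big_ltn ?subn_gt0; last by case/andP: bc.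
rewrite -[LHS]/(qmul _ _ _) qmon_mull; case: mleP => // le0; exfalso.
have [|v vE] := @vertex_of a b; first lia.
by have := le0 v; rewrite !mcoefE vE !addn0 eqxx.
Qed.

(* The difference b - a is constant along the chain of (a, b, c), and edges
   change it by at most 1; hence two trivial cases and one for each of the
   values 0, 1 and -1 of (b' - a') - (b - a). *)
Definition nested (t t' : nat * nat * nat) : bool :=
  let: (a, b, c) := t in let: (a', b', c') := t' in
  [|| (b' + a >= b + a' + 2)%N, (b + a' >= b' + a + 2)%N,
      [&& b' + a == b + a', b < b' & c' < c]%N,
      [&& b' + a == b + a' + 1, b < b' & c' <= c]%N
    | [&& b + a' == b' + a + 1, b <= b' & c' < c]%N].

(** Moving the generator past the whole chain costs [q] to the sum of the exponents [e k]; this sum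
    vanishes because the chain contains either both neighbours of the generator on its diagonal,
    with opposite signs, or neither. *)
Lemma chain_gen_comm a b c i j :
  (0 < a < b)%N -> (b < c <= N.+1)%N -> (0 < i < j)%N && (j <= N)%N ->
  nested (a, b, c) (i, j, j.+1) -> GRing.comm (chain a b c) (gen N hq i j).
Proof.
move=> ab bc ij nest.
pose e k : int := (nat_edge (a + k) (b + k) i j)%:Z
                - (nat_edge i j (a + k) (b + k))%:Z.
suff e0 : \sum_(0 <= k < c - b) e k = 0.
  rewrite /GRing.comm (@prod_qcomm _ _ e) ?e0 ?scale1r // => k kn.
  by apply: gen_qcomm => //; lia.
(* [u] and [w] are the second coordinates of the neighbours of [(i, j)] on the diagonal of the
   chain, with the edge towards [(i, j)] and away from it respectively. If the diagonals are at
   least 2 apart there is no edge, and [u = w = 0] makes the two terms cancel. *)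
have [u [w [uw eE]]] : exists u w,
    (b <= u < b + (c - b))%N = (b <= w < b + (c - b))%N /\
    forall k, e k = (b + k == u)%N%:Z - (b + k == w)%N%:Z.
  rewrite /e /nat_edge; case/or4P: nest => [?|?|?|/orP[]?].
  - by exists 0%N, 0%N; split=> [|k]; lia.
  - by exists 0%N, 0%N; split=> [|k]; lia.
  - by exists j.+1, j.-1; split=> [|k]; lia.
  - by exists j.-1, j; split=> [|k]; lia.
  - by exists j, j.+1; split=> [|k]; lia.
by rewrite (eq_bigr _ (fun k _ => eE k)) sumrB !sum_eqn uw subrr.
Qed.

(** The inequalities of [nested] pass to each single generator of the inner chain, so these commute
    with the outer chain one by one. *)
Lemma chain_comm a b c a' b' c' :
  (0 < a < b)%N -> (b < c <= N.+1)%N -> (0 < a' < b')%N ->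
  (b' < c' <= N.+1)%N -> nested (a, b, c) (a', b', c') ->
  GRing.comm (chain a b c) (chain a' b' c').
Proof.
move=> ab bc ab' bc' nest; rewrite [chain a' b' c']/chain big_nat.
apply: commr_prod => l ln; apply: chain_gen_comm => //; first lia.
by move: nest; rewrite /nested; lia.
Qed.

(* [qtorus] unfolds to a function type, so [q] and [hq] cannot be inferred. *)
Local Notation qe := (@qexp R N q hq).

(** The coefficient at [c] of a product involves only coefficients at multi-indices below [c]. There
    both exponentials agree with their truncations [P] at degree [mdeg c], which are polynomials in
    commuting elements. *)
Lemma qexp_comm (x y : T) :
  x (mzero N) = 0 -> y (mzero N) = 0 -> GRing.comm x y ->
  GRing.comm (qe x) (qe y).
Proof.
move=> x0 y0 xy; apply/qtorusP => c.
pose P (z : T) : T := \sum_(n < (mdeg c).+1)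
  (\prod_(k < n) (1 - q ^+ k.+1))^-1 *: (- z) ^+ n.
have PE z a : z (mzero N) = 0 -> mle a c -> qe z a = P z a.
  move=> z0 ac; apply: qexpE => //.
  by rewrite ltnS -(msubK ac) mdegD leq_addr.
have PM (z w : T) : z (mzero N) = 0 -> w (mzero N) = 0 ->
    (qe z * qe w) c = (P z * P w) c.
  move=> z0 w0; rewrite !qmulE; apply: eq_big_seq => a.
  by rewrite mem_below => ac; rewrite !PE ?mle_sub.
rewrite !PM //; congr ((_ : T) c); apply: commr_sum => n _.
rewrite /GRing.comm -scalerAl -scalerAr; congr (_ *: _); apply: commrX.
apply/commrN/commr_sym/commr_sum => m _.
rewrite /GRing.comm -scalerAl -scalerAr; congr (_ *: _).
exact/commrX/commrN/commr_sym.
Qed.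

Lemma Rabc_comm (t t' : nat * nat * nat) :
  t \in triples N.+1 -> t' \in triples N.+1 ->
  [|| t == t', nested t t' | nested t' t] ->
  GRing.comm (let: (a, b, c) := t in Rabc N hq a b c)
             (let: (a, b, c) := t' in Rabc N hq a b c).
Proof.
move: t t' => [[a b] c] [[a' b'] c'].
rewrite !mem_triples => /andP[ab bc] /andP[ab' bc'] /or3P[/eqP[-> -> ->]//||] H.
  by apply: qexp_comm (chain_comm ab bc ab' bc' H); rewrite chain0.
apply: commr_sym.
by apply: qexp_comm (chain_comm ab' bc' ab bc H); rewrite chain0.
Qed.

End Commutation.

(** * Reindexing of triples, and comparison of the products *)

(** The factor at [t] in the third pair of products is [Rabc] at [flip t]; being an involution on
    the triples, [flip] only permutes the factors. *)
Definition flip (t : nat * nat * nat) : nat * nat * nat :=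
  let: (a, b, c) := t in (a, (c + a - b)%N, c).

Lemma flip_triples n t : t \in triples n -> flip t \in triples n.
Proof. by case: t => [[a b] c]; rewrite !mem_triples; lia. Qed.

Lemma flipK n : {in triples n, involutive flip}.
Proof.
by move=> [[a b] c]; rewrite mem_triples => abc; congr (_, _, _); lia.
Qed.

Lemma perm_flip n s : perm_eq s (triples n) -> perm_eq (map flip s) (triples n).
Proof.
move=> sn; apply: uniq_perm; rewrite ?triples_uniq //.
  rewrite map_inj_in_uniq ?(perm_uniq sn) ?triples_uniq // => x y.
  by rewrite !(perm_mem sn) => /flipK {2}<- /flipK {2}<- ->.
move=> t; apply/mapP/idP => [[u us ->]|tn].
  by rewrite flip_triples // -(perm_mem sn).
by exists (flip t); rewrite ?(perm_mem sn) ?flip_triples ?(flipK tn).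
Qed.

Theorem lemma2 (R : realType) (q : R) (hq : 0 < q < 1) (N : nat)
    (hN : (2 <= N)%N) :
  let TN : qtorus N hq :=
    \prod_(t <- sort lex3 (triples N.+1)) let: (a, b, c) := t in
      Rabc N hq a b c in
  [/\ TN = \prod_(p <- sort lex2 (pairs N)) (let: (a, b) := p in
             Rab N hq a b)
      /\ TN = \prod_(p <- sort colex2 (pairs N)) (let: (a, b) := p in
             Rab N hq a b),
      TN = \prod_(t <- sort lex3 (triples N.+1)) (let: (a, b, c) := t in
             Rabc N hq a b c)
      /\ TN = \prod_(t <- sort colex3 (triples N.+1)) (let: (a, b, c) := t in
             Rabc N hq a b c)
    & TN = \prod_(t <- sort lex3 (triples N.+1)) (let: (a, b, c) := t in
             Rabc N hq a (c + a - b) c)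
      /\ TN = \prod_(t <- sort colex3 (triples N.+1)) (let: (a, b, c) := t in
             Rabc N hq a (c + a - b) c)].
Proof.
pose F (t : nat * nat * nat) : qtorus N hq :=
  let: (a, b, c) := t in Rabc N hq a b c.
move=> TN.
(* Every claim about triples reduces to arithmetic: pairs reversed with respect to [lex3] must be
   nested one way or the other. *)
have TNE (r : rel (nat * nat * nat)) s : perm_eq s (triples N.+1) ->
    pairwise r s ->
    {in triples N.+1 &, forall t t', lex3 t t' -> r t' t ->
      [|| t == t', nested t t' | nested t' t]} ->
    TN = \prod_(t <- s) F t.
  move=> sT rs nest; apply: (prod_reorder _ (sort_lex3 _) rs).
    by rewrite (permPr sT) perm_sort.
  move=> t t'; rewrite !mem_sort => tT tT' l3 rt.
  by apply: Rabc_comm => //; exact: nest.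
(* Expanding each [Rab] gives a product over triples. The gap of 2 puts the chains of two reversed
   blocks on diagonals without edges between them. *)
have pairsE (r : rel (nat * nat)) s : perm_eq s (pairs N) -> pairwise r s ->
    {in pairs N &, forall p p', lex2 p p' -> r p' p ->
      p = p' \/ (p'.2 + p.1 + 2 <= p.2 + p'.1)%N} ->
    TN = \prod_(p <- s) (let: (a, b) := p in Rab N hq a b).
  move=> sP rs gap.
  pose st := [seq (p, c) | p <- s, c <- index_iota p.2.+1 N.+2].
  (* Blocks follow [r], and within a block [c] increases. The test [t.1 != t'.1] keeps a reflexive
     [r] from relating all triples of one block. *)
  pose r3 (t t' : nat * nat * nat) :=
    (t.1 != t'.1) && r t.1 t'.1 || (t.1 == t'.1) && (t.2 <= t'.2)%N.
  have -> : \prod_(p <- s) (let: (a, b) := p in Rab N hq a b) =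
            \prod_(t <- st) F t.
    by rewrite big_allpairs_dep; apply: eq_bigr => -[a b] _.
  have us : uniq s by rewrite (perm_uniq sP) pairs_uniq.
  have ust : uniq st.
    apply: allpairs_uniq_dep => // [p _|]; first exact: iota_uniq.
    by move=> [p c] [p' c'] _ _ /= [-> ->].
  have mst : st =i triples N.+1.
    move=> [[a b] c]; apply/allpairsPdep/idP.
      move=> [[x y] [z [/= xs zs [-> -> ->]]]].
      move: xs zs; rewrite (perm_mem sP) mem_pairs mem_index_iota mem_triples.
      lia.
    rewrite mem_triples => abc; exists (a, b), c.
    by rewrite (perm_mem sP) mem_pairs mem_index_iota; split=> //=; lia.
  apply: (TNE r3).
  - exact: uniq_perm ust (triples_uniq _) mst.
  - rewrite /st; elim: (s) us rs => //= p s' IH /andP[ps us'] /andP[ra rs'].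
    rewrite pairwise_cat IH // andbT; apply/andP; split.
      apply/allrelP => t t' /mapP[c _ ->] /allpairsPdep[p' [c' [p's _ ->]]].
      rewrite /r3 /= (allP ra) // andbT; apply/orP; left.
      by apply: contraNneq ps => ->.
    rewrite pairwise_map; apply: (@sub_pairwise _ leq) => [c c' cc|].
      by rewrite /r3 /= eqxx cc orbT.
    by rewrite -(sorted_pairwise leq_trans) iota_sorted.
  move=> [[a b] c] [[a' b'] c'].
  rewrite !mem_triples lex3P /r3 /= => tT tT' l3 /orP[/andP[ne rp]|].
    have [||||e|] // := gap (a, b) (a', b').
    + by rewrite mem_pairs; lia.
    + by rewrite mem_pairs; lia.
    + by rewrite lex2P /=; lia.
    + by rewrite e eqxx in ne.
    + by rewrite /=; lia.
  by move: l3; rewrite !xpair_eqE; lia.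
(* Applying [flip] to the sorted list turns the factors into [F], and the list is then ordered by
   [r] pulled back along [flip]. *)
have flipTN (r : rel (nat * nat * nat)) :
    pairwise r (sort r (triples N.+1)) ->
    {in triples N.+1 &, forall t t', lex3 t t' -> r (flip t') (flip t) ->
      [|| t == t', nested t t' | nested t' t]} ->
    TN = \prod_(t <- sort r (triples N.+1)) (let: (a, b, c) := t in
           Rabc N hq a (c + a - b) c).
  move=> rs nest.
  transitivity (\prod_(t <- map flip (sort r (triples N.+1))) F t).
    apply: (TNE (relpre flip r)) nest; first by apply: perm_flip; rewrite perm_sort.
    rewrite pairwise_map.
    rewrite -(eq_in_pairwise (P := mem (triples N.+1)) (r := r)) //.
      by move=> t t' tT tT' /=; rewrite !(@flipK N.+1).
    by apply/allP => t; rewrite mem_sort.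
  by rewrite big_map; apply: eq_bigr => -[[a b] c] _.
split; split=> //.
- apply: (pairsE lex2 _ _ (sort_lex2 _)); rewrite ?perm_sort //.
  move=> [a b] [a' b'] _ _; rewrite !lex2P /= => l l'; left.
  by congr (_, _); lia.
- apply: (pairsE colex2 _ _ (sort_colex2 _)); rewrite ?perm_sort //.
  move=> [a b] [a' b'] _ _; rewrite /colex2 !lex2P /= => l l'.
  (* A reversed pair of distinct indices has [a < a'] and [b' < b], and these two strict
     inequalities add up to the gap of 2. *)
  have [[-> ->]|] : (a = a' /\ b = b') \/ (b' + a + 2 <= b + a')%N by lia.
    by left.
  by right.
- apply: (TNE colex3 _ _ (sort_colex3 _)); rewrite ?perm_sort //.
  (* For distinct triples, reversal means [c' < c], or [c' = c] with [a < a'] and [b' < b]; in the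
     latter case the diagonals are at least 2 apart. *)
  move=> [[a b] c] [[a' b'] c'].
  by rewrite !mem_triples /colex3 !lex3P /= !xpair_eqE; lia.
(* Since [flip] fixes the first entry, reversal forces [a = a']. *)
- apply: (flipTN _ (sort_lex3 _)) => -[[a b] c] [[a' b'] c'].
  by rewrite !mem_triples !lex3P /= !xpair_eqE; lia.
- apply: (flipTN _ (sort_colex3 _)) => -[[a b] c] [[a' b'] c'].
  by rewrite !mem_triples /colex3 !lex3P /= !xpair_eqE; lia.
Qed.
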